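(* Let $c,m,s$ be positive integers, let $A_1,\dots,A_s$ be $0$-$1$-matrices with $c$ rows and at most $m$ columns, $A_i=\big[\ast_{\varnothing\ne T\in 2^{[c]}}A_T(k_T^{(i)})\big]$ with $k_T^{(i)}\in\mathbb{N}_0$, and for $n\ge m$ let $I_n=\langle\operatorname{Sym}(n)\cdot(\mathbf{x}^{A_1},\dots,\mathbf{x}^{A_s})\rangle\subset R_n$. If $n\ge m$, then the Alexander dual $I_n^\vee$ is minimally generated by the $\operatorname{Sym}(n)$-orbits of the monomials $\mathbf{x}^B$ with $B$ in the set $$\mathcal{G}(I_n^\vee)=\bigcup_{(\mathcal{F},\mathcal{C})\in\mathcal{P}}\Big[\mathcal{G}_{\mathcal{F},\mathcal{C}}(n)-\bigcup_{\substack{(\mathcal{F}',\mathcal{C}')\in\mathcal{P}\\(\mathcal{F}',\mathcal{C}')\ne(\mathcal{F},\mathcal{C})}}\big(I_{\mathcal{F}',\mathcal{C}'}(n)-\mathcal{G}_{\mathcal{F}',\mathcal{C}'}(n)\big)\Big].$$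
   Context: Basic notation: $\mathbb{N}$ = positive integers, $\mathbb{N}_0$ = nonnegative integers; $R_n=\mathbf{k}[x_{i,j}\mid i\in[c],j\in[n]]$ over a field $\mathbf{k}$, with $\operatorname{Sym}(n)$ acting by $\sigma\cdot x_{i,j}=x_{i,\sigma(j)}$. For $B=[b_{i,j}]\in\{0,1\}^{c\times n}$, $\mathbf{x}^B=\prod x_{i,j}^{b_{i,j}}$; matrices with fewer than $n$ columns are padded with zero columns to $c\times n$ matrices. For $T\subseteq[c]$, $A_T(k)$ is the $c\times k$ matrix all of whose columns are the indicator vector of $T$; $\ast$ denotes horizontal concatenation, and $[\ast_{T\in\mathcal{S}}A_T(k_T)]$ is the concatenation of the blocks $A_T(k_T)$, $T\in\mathcal{S}$. Throughout, matrices are considered up to permutation of their columns. The Alexander dual of a squarefree monomial ideal $I$ is $I^\vee=\langle\mathbf{m}\mid P_{\mathbf{m}}\in\operatorname{Ass}(I)\rangle$, where $P_{\mathbf{m}}$ is generated by the variables dividing the squarefree monomial $\mathbf{m}$. ''Minimally generated by the orbits'' means that the union of the orbits is the unique minimal monomial generating set. Order ideals: an order ideal of $2^{[c]}$ is a subset closed under taking supersets; here a proper order ideal is one with $\varnothing\ne J\subsetneq 2^{[c]}$. $\langle\mathcal{C}\rangle$ is the order ideal generated by $\mathcal{C}$; $\overline{J}=\{[c]-T\mid T\in J\}$. For an $s$-tuple $\mathbf{J}=(J_1,\dots,J_s)$ of proper order ideals of $2^{[c]}$ and $\Lambda\subseteq[s]$, let $D_{\mathbf{J},\Lambda}$ be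 the set of inclusion-minimal elements of $\bigcap_{k\in\Lambda}\overline{J}_k-\bigcup_{k\in[s]-\Lambda}\overline{J}_k$ if $\Lambda\ne\varnothing$, and of $2^{[c]}-(\overline{J}_1\cup\dots\cup\overline{J}_s)$ if $\Lambda=\varnothing$. The set $\mathcal{P}$: it consists of all pairs $(\mathcal{F},\mathcal{C})$ for which there is an $s$-tuple $\mathbf{J}=(J_1,\dots,J_s)$ of proper order ideals of $2^{[c]}$ such that $\mathcal{C}=D_{\mathbf{J},\varnothing}$ and $\mathcal{F}=(\ell_S\in\mathbb{N}\mid S\in F)$ for some (possibly empty) subset $F\subseteq 2^{[c]}$ with: $F\cap\langle\mathcal{C}\rangle=\varnothing$; $F\subseteq\bigsqcup_{\varnothing\ne\Lambda\subseteq[s]}D_{\mathbf{J},\Lambda}$; and, setting $\ell_S=0$ for $S\in(\overline{J}_1\cup\dots\cup\overline{J}_s)-F$, one has $\sum_{T\in J_i}k_T^{(i)}>\sum_{S\in\overline{J}_i}\ell_S$ for all $i\in[s]$. (Note $\varnothing\notin J_i$, so only $k_T^{(i)}$ with $T\neq\varnothing$ occur.) For $(\mathcal{F},\mathcal{C})\in\mathcal{P}$ with $\mathcal{F}=(\ell_S\mid S\in F)$, set $$\mathcal{G}_{\mathcal{F},\mathcal{C}}(n)=\Big\{\big[\ast_{S\in F}A_S(\ell_S)\big]\ast\big[\ast_{S\in\mathcal{C}}A_S(\ell_S)\big]\ \Big|\ \ell_S\in\mathbb{N}_0\text{ for }S\in\mathcal{C},\ \sum_{S\in\mathcal{C}}\ell_S=n-\sum_{S\in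 F}\ell_S\Big\},$$ and let $I_{\mathcal{F},\mathcal{C}}(n)$ be the set of all $B\in\{0,1\}^{c\times n}$ such that $\mathbf{x}^B$ lies in the ideal of $R_n$ generated by the $\operatorname{Sym}(n)$-orbits of the monomials $\mathbf{x}^A$, $A\in\mathcal{G}_{\mathcal{F},\mathcal{C}}(n)$. *)

(* Defs.v *)
From mathcomp Require Import all_boot all_order all_fingroup all_algebra.
From mathcomp Require Export mpoly.

Set Implicit Arguments.
Unset Strict Implicit.
Unset Printing Implicit Defensive.

Import GRing.Theory.
Local Open Scope ring_scope.

(* Ideals of a commutative ring, as predicates *)

Definition is_ideal (R : comNzRingType) (I : R -> Prop) : Prop :=
  [/\ I 0, forall p q, I p -> I q -> I (p + q)
    & forall a p, I p -> I (a * p)].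

Definition ideal_gen (R : comNzRingType) (G : R -> Prop) (p : R) : Prop :=
  exists2 r : seq (R * R), forall u, u \in r -> G u.2
                         & p = \sum_(u <- r) u.1 * u.2.

Definition is_prime_ideal (R : comNzRingType) (P : R -> Prop) : Prop :=
  [/\ is_ideal P, ~ P 1 & forall a b, P (a * b) -> P a \/ P b].

(* Ass(I) means Ass(R/I): the primes of the form I : f. *)
Definition is_associated (R : comNzRingType) (I P : R -> Prop) : Prop :=
  is_prime_ideal P /\ exists f, forall g, P g <-> I (g * f).

Definition squarefree_mon N (m : 'X_{1..N}) : Prop := forall v, (m v <= 1)%N.

(* P_m *)
Definition support_ideal (K : fieldType) N (m : 'X_{1..N}) :
    {mpoly K[N]} -> Prop :=
  ideal_gen (fun p => exists2 v : 'I_N, (0 < m v)%N & p = 'X_v).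
Arguments support_ideal K {N} m _.

Definition alexander_dual (K : fieldType) N (I : {mpoly K[N]} -> Prop) :
    {mpoly K[N]} -> Prop :=
  ideal_gen (fun p => exists m : 'X_{1..N},
    [/\ squarefree_mon m, is_associated I (support_ideal K m) & p = 'X_[m]]).

Definition min_monomial_gens (K : fieldType) N (I G : {mpoly K[N]} -> Prop) :
    Prop :=
  [/\ forall p, G p -> exists m : 'X_{1..N}, p = 'X_[m],
      forall p, I p <-> ideal_gen G p
    & forall G' : {mpoly K[N]} -> Prop,
        (forall p, G' p -> G p) -> (forall p, I p <-> ideal_gen G' p) ->
        forall p, G p -> G' p].

Definition unique_min_monomial_gens (K : fieldType) N
    (I G : {mpoly K[N]} -> Prop) : Prop :=
  min_monomial_gens I G /\
  forall G', min_monomial_gens I G' -> forall p, G' p <-> G p.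

(* R_n = K[x_{i,j}] is {mpoly K[c * n]}, the variable x_{i,j} being numbered
   by mxvec_index i j, and matrices over {0,1} are matrices over bool. *)

Definition xvar (K : fieldType) c n (i : 'I_c) (j : 'I_n) : {mpoly K[c * n]} :=
  'X_(mxvec_index i j).

(* The K-algebra endomorphism sending x_{i,j} to x_{i,sigma(j)} *)
Definition sym_act (K : fieldType) c n (sigma : 'S_n) (p : {mpoly K[c * n]}) :
    {mpoly K[c * n]} :=
  p \mPo [tuple mxvec (\matrix_(i < c, j < n) xvar K i (sigma j)) 0 v
         | v < c * n].

Definition xmon (K : fieldType) c n (B : 'M[bool]_(c, n)) : {mpoly K[c * n]} :=
  \prod_(i < c) \prod_(j < n) xvar K i j ^+ B i j.

Definition orbits (K : fieldType) c n (M : 'M[bool]_(c, n) -> Prop)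
    (p : {mpoly K[c * n]}) : Prop :=
  exists B, M B /\ exists sigma : 'S_n, p = sym_act sigma (xmon K B).
Arguments orbits K {c n} M _.

(* Only used for w <= n *)
Definition pad c w n (A : 'M[bool]_(c, w)) : 'M[bool]_(c, n) :=
  \matrix_(i < c, j < n) oapp (A i) false (insub (j : nat)).

(* Equality up to a permutation of columns; it forces w = w'. *)
Definition col_equiv c w w' (A : 'M[bool]_(c, w)) (B : 'M[bool]_(c, w')) :
    bool :=
  perm_eq [seq col j A | j <- enum 'I_w] [seq col j B | j <- enum 'I_w'].

(* A_T(k) *)
Definition block c (T : {set 'I_c}) (k : nat) : 'M[bool]_(c, k) :=
  \matrix_(i < c, j < k) (i \in T).

Definition concat_blocks c (S : {set {set 'I_c}}) (k : {set 'I_c} -> nat) :=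
  \mxrow_(a < #|S|) block (enum_val a) (k (enum_val a)).

Definition orbit_ideal (K : fieldType) c s n (w : 'I_s -> nat)
    (A : forall i, 'M[bool]_(c, w i)) : {mpoly K[c * n]} -> Prop :=
  ideal_gen (orbits K (fun B => exists i, B = pad n (A i))).
Arguments orbit_ideal K {c s} n {w} A _.

(* Order ideals of 2^[c], closed under taking supersets *)

Definition proper_order_ideal c (J : {set {set 'I_c}}) : bool :=
  [&& J != set0, J != setT
    & [forall S in J, forall T : {set 'I_c}, (S \subset T) ==> (T \in J)]].

Definition order_ideal_gen c (C : {set {set 'I_c}}) : {set {set 'I_c}} :=
  [set T : {set 'I_c} | [exists S in C, S \subset T]].

Definition bar c (J : {set {set 'I_c}}) : {set {set 'I_c}} :=
  [set ~: T | T in J].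

Definition min_elts c (X : {set {set 'I_c}}) : {set {set 'I_c}} :=
  [set S : {set 'I_c} | minset (fun T : {set 'I_c} => T \in X) S].

(* The intersection over the empty L is the full power set. *)
Definition Dset c s (J : 'I_s -> {set {set 'I_c}}) (L : {set 'I_s}) :
    {set {set 'I_c}} :=
  min_elts (\bigcap_(k in L) bar (J k) :\: \bigcup_(k in ~: L) bar (J k)).

(* A pair (calF, C). A family calF = (l_S >= 1 | S in F) is encoded by its
   extension by zero to all of 2^[c], from which F is recovered as the
   support. *)
Definition FCpair c := ({ffun {set 'I_c} -> nat} * {set {set 'I_c}})%type.

Definition Fsupp c (l : {ffun {set 'I_c} -> nat}) : {set {set 'I_c}} :=
  [set S | l S != 0%N].

Definition in_P c s (k : 'I_s -> {set 'I_c} -> nat) (FC : FCpair c) : Prop :=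
  let: (l, C) := FC in
  exists J : 'I_s -> {set {set 'I_c}},
    [/\ forall i, proper_order_ideal (J i),
        C = Dset J set0,
        Fsupp l :&: order_ideal_gen C = set0,
        Fsupp l \subset \bigcup_(L : {set 'I_s} | L != set0) Dset J L
      & forall i,
          (\sum_(S in bar (J i)) l S < \sum_(T in J i) k i T)%N].

Definition G_FC c (FC : FCpair c) n (B : 'M[bool]_(c, n)) : Prop :=
  let: (l, C) := FC in
  exists2 l' : {set 'I_c} -> nat,
    (\sum_(S in Fsupp l) l S + \sum_(S in C) l' S = n)%N
  & col_equiv B (row_mx (concat_blocks (Fsupp l) l) (concat_blocks C l')).

Definition I_FC (K : fieldType) c (FC : FCpair c) n (B : 'M[bool]_(c, n)) :
    Prop :=
  ideal_gen (orbits K (G_FC FC (n := n))) (xmon K B).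

Definition G_dual (K : fieldType) c s (k : 'I_s -> {set 'I_c} -> nat) n
    (B : 'M[bool]_(c, n)) : Prop :=
  exists FC : FCpair c,
    [/\ in_P k FC, G_FC FC B
      & ~ exists FC' : FCpair c,
          [/\ in_P k FC', FC' <> FC & I_FC K FC' B /\ ~ G_FC FC' B]].

(* Main.v *)
Require Import Defs.
From mathcomp Require Import all_boot all_order all_fingroup all_algebra.
From Stdlib Require Import Classical.

(* A squarefree monomial x^B is a generator of the Alexander dual iff B is a
   minimal vertex cover of the monomials in the orbits of the x^(A_i).  By Hall's
   theorem, B covers the orbit of x^(A_i) iff some order ideal J_i contains
   more column supports of A_i than complements of column supports of B.  If B is
   minimal for a fixed choice of J, no column of B can be shrunk without entering
   a new set bar J_i, so every column lies in some D_(J,L) and B is in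
   G_(F,C)(n) for a pair in P.  Conversely members of G_(F,C)(n) are covers, and
   each G_(F,C)(n) is an antichain up to column permutation because its columns
   outside C are prescribed; hence removing the non-generators of the I_(F',C')(n)
   leaves exactly the minimal covers. *)

Set Implicit Arguments.
Unset Strict Implicit.
Unset Printing Implicit Defensive.

Import GRing.Theory.

(** * Covers and order ideals *)

(* Rado's proof: if two neighbours of x could neither be deleted without
   violating Hall's condition, submodularity of the neighbourhood size would
   contradict the condition. *)
Lemma hall_marriage (L R : finType) (F : L -> {set R}) :
  (forall X : {set L}, #|X| <= #|\bigcup_(x in X) F x|) ->
  exists2 f : L -> R, injective f & forall x, f x \in F x.
Proof.
have [N] := ubnP (\sum_x #|F x|); elim: N F => // N IH F.
rewrite ltnS => leN hallF.
have [/existsP[x /card_gt1P[y1 [y2 [y1F y2F y12]]]]|small] :=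
  boolP [exists x, 1 < #|F x|]; last first.
  have F1 x : exists y, F x = [set y].
    apply/cards1P; rewrite eqn_leq leqNgt; apply/andP; split.
      by have := small; rewrite negb_exists => /forallP.
    by have := hallF [set x]; rewrite cards1 big_set1.
  have /fin_all_exists[f fF] := F1; exists f => [x x' eqf|x]; last first.
    by rewrite fF set11.
  apply/eqP/contraT => neq; have := hallF [set x; x'].
  by rewrite cards2 neq big_setU1 ?inE //= big_set1 !fF eqf setUid cards1.
(* For [y] in [F x], [del y] has smaller total size than [F], so the induction applies to it unless
   it violates Hall's condition. *)
pose del y z := if z == x then F x :\ y else F z.
pose U (X : {set L}) := \bigcup_(z in X) F z.
have delP y : y \in F x ->
    (exists2 f : L -> R, injective f & forall x, f x \in F x) \/
    exists2 X : {set L}, x \notin X & #|U X :|: F x :\ y| <= #|X|.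
  move=> yF; have [/forallP ok|] :=
    boolP [forall X : {set L}, #|X| <= #|\bigcup_(z in X) del y z|].
    left; have [|f injf fdel] := IH (del y) _ ok.
      apply: leq_trans leN; rewrite (bigD1 x) //= [X in _ < X](bigD1 x) //=.
      rewrite {1}/del eqxx (cardsD1 y (F x)) yF add1n addSn ltnS leq_add2l.
      by apply: leq_sum => z /negPf zx; rewrite /del zx.
    exists f => // z; have := fdel z; rewrite /del.
    by case: eqP => // ->; rewrite inE => /andP[].
  rewrite negb_forall => /existsP[Z]; rewrite -ltnNge => ltZ; right.
  (* A set avoiding [x] has the same neighbours in both families, so it cannot be a violator. *)
  have xZ : x \in Z.
    apply: contraLR ltZ => xZ; rewrite -leqNgt.
    rewrite (eq_bigr F) // => z zZ; rewrite /del.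
    by case: eqP => // zx; rewrite zx (negPf xZ) in zZ.
  exists (Z :\ x); first by rewrite !inE eqxx.
  move: ltZ; rewrite (cardsD1 x Z) xZ add1n ltnS; apply: leq_trans.
  rewrite (big_setD1 x) //= {1}/del eqxx setUC.
  rewrite /U (eq_bigr (del y)) // => z; rewrite !inE => /andP[/negPf zx _].
  by rewrite /del zx.
have [//|[X1 xX1 le1]] := delP _ y1F; have [//|[X2 xX2 le2]] := delP _ y2F.
(* As [y1 != y2], the two punctured copies of [F x] together cover [F x]. Since [x] lies in neither
   [X1] nor [X2], the left side is the right side plus one, which is absurd. *)
have : #|x |: (X1 :|: X2)| + #|X1 :&: X2| <= #|X1| + #|X2|.
  apply: leq_trans (leq_add le1 le2); rewrite -[leqRHS]cardsUI.
  apply: leq_add; apply: leq_trans (hallF _) (subset_leq_card _).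
    apply/bigcupsP => z /setU1P[->|zX].
      apply/subsetP => y yF; rewrite !inE yF.
      by have [->|] := eqVneq y y1; rewrite ?y12 ?orbT.
    move: zX; rewrite inE => /orP[] zX; apply/subsetP => y yF.
      by rewrite !inE (_ : y \in U X1) //; apply/bigcupP; exists z.
    by rewrite !inE (_ : y \in U X2) ?orbT //; apply/bigcupP; exists z.
  apply/bigcupsP => z /setIP[z1 z2]; apply/subsetP => y yF; rewrite !inE.
  by apply/andP; split; apply/orP; left; apply/bigcupP; exists z.
by rewrite cardsU1 inE negb_or xX1 xX2 /= -addnA cardsUI add1n ltnn.
Qed.

Lemma barE c (J : {set {set 'I_c}}) (S : {set 'I_c}) : (S \in bar J) = (~: S \in J).
Proof.
apply/imsetP/idP => [[T TJ ->]|SJ]; first by rewrite setCK.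
by exists (~: S); rewrite ?setCK.
Qed.

Lemma sum_card_fibres (T : finType) n (t : 'I_n -> T) (J : {set T}) :
  \sum_(S in J) #|[set j | t j == S]| = #|[set j | t j \in J]|.
Proof.
rewrite -sum1dep_card (partition_big t (mem J)) //=.
apply: eq_bigr => S SJ; rewrite -sum1dep_card; apply: eq_bigl => j.
by case: eqP => [->|]; rewrite ?andbT ?andbF.
Qed.

(* Hall's theorem for the relation [disjoint t j & b p]: an index j with t j
   empty is related to every p, so a deficient set contains none of them and
   generates a proper order ideal. *)
Lemma transversal_order_idealP c n (t b : 'I_n -> {set 'I_c}) :
  (forall sigma : 'S_n, exists j, ~~ [disjoint t j & b (sigma j)]) <->
  exists2 J : {set {set 'I_c}}, proper_order_ideal J &
    #|[set p | b p \in bar J]| < #|[set j | t j \in J]|.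
Proof.
split=> [cov|[J /and3P[_ _ /'forall_implyP upJ] ltJ] sigma]; last first.
  (* Pigeonhole: [sigma] cannot send all [j] with [t j] in [J] into the smaller set of [p] with
     [b p] in [bar J]. For an escaping [j], upward closure prevents [t j] from lying in the
     complement of [b (sigma j)]. *)
  have /subsetPn[j] : ~~ ([set j | t j \in J] \subset
                          [set j | b (sigma j) \in bar J]).
    apply: contraL ltJ => /subset_leq_card; rewrite -leqNgt => /leq_trans; apply.
    rewrite -(card_imset _ (@perm_inj _ sigma)); apply: subset_leq_card.
    by apply/subsetP => _ /imsetP[j jb ->]; move: jb; rewrite !inE.
  rewrite !inE barE => tJ bJ; exists j; rewrite disjoints_subset; apply: contra bJ.
  move: (t j) tJ => T TJ Tb.
  by have /forallP/(_ (~: b (sigma j)))/implyP := upJ _ TJ; apply.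
pose F j := [set p | [disjoint t j & b p]].
have [/forallP hall|] :=
  boolP [forall X : {set 'I_n}, #|X| <= #|\bigcup_(j in X) F j|].
  have [f injf fF] := hall_marriage hall.
  have [j] := cov (perm injf); rewrite permE.
  by have := fF j; rewrite inE => ->.
rewrite negb_forall => /existsP[X]; rewrite -ltnNge => ltX.
pose J := [set T : {set 'I_c} | [exists j in X, t j \subset T]].
have N0 : set0 \notin J.
  apply: contraL ltX => /[!inE] /exists_inP[j jX]; rewrite subset0 => /eqP tj0.
  rewrite -leqNgt; apply: leq_trans (max_card _) _; rewrite -cardsT.
  apply: subset_leq_card; apply/subsetP => p _; apply/bigcupP; exists j => //.
  by rewrite inE tj0 -setI_eq0 set0I.
have subX : X \subset [set j | t j \in J].
  by apply/subsetP => j jX; rewrite !inE; apply/exists_inP; exists j.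
exists J.
  apply/and3P; split.
  - have /card_gt0P[j jX] : 0 < #|X| by apply: leq_trans ltX.
    by apply/set0Pn; exists (t j); have := subsetP subX j jX; rewrite inE.
  - by apply: contra N0 => /eqP ->; rewrite inE.
  - apply/'forall_implyP => S /[!inE] /exists_inP[j jX tS].
    apply/'forall_implyP => T ST; rewrite inE; apply/exists_inP; exists j => //.
    exact: subset_trans ST.
apply: leq_trans (subset_leq_card subX); apply: leq_ltn_trans ltX.
apply: subset_leq_card; apply/subsetP => p; rewrite inE barE inE.
case/exists_inP=> j jX; rewrite -disjoints_subset => dis.
by apply/bigcupP; exists j; rewrite // inE.
Qed.

(** * Minimal covers and column multiplicities *)

Lemma card_fibre_neq0 (T : finType) n (t : 'I_n -> T) S :
  (#|[set j | t j == S]| != 0) = [exists j, t j == S].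
Proof.
rewrite -lt0n; apply/card_gt0P/existsP => -[j jS]; exists j.
  by rewrite inE in jS. by rewrite inE.
Qed.

(** The Hall criterion for covering, with the columns of the padded [A_i] counted by [k i]. A proper
    order ideal omits the empty set, so padding columns do not contribute. *)
Definition feasible c s (k : 'I_s -> {set 'I_c} -> nat) n
    (b : 'I_n -> {set 'I_c}) : Prop :=
  forall i, exists2 J : {set {set 'I_c}}, proper_order_ideal J &
    #|[set p | b p \in bar J]| < \sum_(T in J) k i T.

Definition min_feasible c s (k : 'I_s -> {set 'I_c} -> nat) n
    (b : 'I_n -> {set 'I_c}) : Prop :=
  feasible k b /\
  forall b' : 'I_n -> {set 'I_c},
    (forall p, b' p \subset b p) -> feasible k b' -> b' =1 b.

(* Membership in G_(F,C)(n) read off column multiplicities: only the columns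
   outside C are prescribed. *)
Definition has_profile c (FC : FCpair c) n (b : 'I_n -> {set 'I_c}) : Prop :=
  forall S, S \notin FC.2 -> #|[set p | b p == S]| = FC.1 S.

Lemma eq_feasible c s (k : 'I_s -> {set 'I_c} -> nat) n
    (b b' : 'I_n -> {set 'I_c}) :
  b =1 b' -> feasible k b -> feasible k b'.
Proof.
move=> eqb fb i; have [J pJ ltJ] := fb i; exists J => //.
by under eq_finset => p do rewrite -eqb.
Qed.

Lemma eq_has_profile c (FC : FCpair c) n (b b' : 'I_n -> {set 'I_c}) :
  b =1 b' -> has_profile FC b -> has_profile FC b'.
Proof. by move=> eqb pb S /pb <-; under eq_finset => p do rewrite -eqb. Qed.

Lemma bar_down c (J : {set {set 'I_c}}) (S T : {set 'I_c}) :
  proper_order_ideal J -> S \subset T -> T \in bar J -> S \in bar J.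
Proof.
case/and3P=> _ _ /forall_inP upJ ST; rewrite !barE => TJ.
by move: (upJ _ TJ) => /forallP/(_ (~: S))/implyP; apply; rewrite setCS.
Qed.

Lemma Dset0P c s (J : 'I_s -> {set {set 'I_c}})
    (S : {set 'I_c}) :
  S \in Dset J set0 -> forall i, S \notin bar (J i).
Proof.
rewrite inE => /minsetp; rewrite inE => /andP[nS _] i.
by apply: contra nS => Si; apply/bigcupP; exists i; rewrite ?inE.
Qed.

Lemma Dset_antichain c s (J : 'I_s -> {set {set 'I_c}}) (L : {set 'I_s})
    (S T : {set 'I_c}) :
  S \in Dset J L -> T \in Dset J L -> S \subset T -> S = T.
Proof.
rewrite !inE => /minsetp SD /minsetP[_ minT] ST.
by apply: minT.
Qed.

(** With [S = T] this separates prescribed from free columns; in general it forbids a prescribed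
    column above a free one. *)
Lemma in_P_notin_C c s (k : 'I_s -> {set 'I_c} -> nat) (FC : FCpair c)
    (S T : {set 'I_c}) :
  in_P k FC -> S \in FC.2 -> S \subset T -> FC.1 T = 0.
Proof.
case: FC => l C [J [_ _ disj _ _]] /= SC ST; apply/eqP/negPn/negP => lT.
have : T \in Fsupp l :&: order_ideal_gen C.
  by rewrite !inE lT; apply/exists_inP; exists S.
by rewrite disj inE.
Qed.

(** Members of C lie in no [bar (J i)], so the free multiplicities never enter the inequalities, and
    the tuple [J] of the pair is itself the witness. *)
Lemma has_profile_feasible c s (k : 'I_s -> {set 'I_c} -> nat) (FC : FCpair c)
    n (b : 'I_n -> {set 'I_c}) :
  in_P k FC -> has_profile FC b -> feasible k b.
Proof.
case: FC => l C [J [pJ CE _ _ ltJ]] prof i; exists (J i) => //.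
rewrite -sum_card_fibres; apply: leq_ltn_trans (ltJ i).
apply: leq_sum => S Si; rewrite prof //=.
by apply: contraL Si; rewrite CE => /Dset0P; apply.
Qed.

(** Once witnesses [J] are fixed, the counts see a column only through its pattern, the set of [i]
    with [b p] in [bar (J i)]. Minimality makes each column minimal for its pattern, and the columns
    with empty pattern form the free part. *)
Lemma min_feasible_has_profile c s (k : 'I_s -> {set 'I_c} -> nat) n
    (b : 'I_n -> {set 'I_c}) :
  min_feasible k b -> exists2 FC : FCpair c, in_P k FC & has_profile FC b.
Proof.
case=> feas minb.
have [J pJ ltJ] := fin_all_exists2 feas.
have bD p : b p \in Dset J [set i | b p \in bar (J i)].
  rewrite inE; apply/minsetP; split=> [|S].
    rewrite inE; apply/andP; split; last by apply/bigcapP => i; rewrite inE.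
    by apply/bigcupP => -[i]; rewrite !inE => /negP.
  rewrite inE => /andP[notS inS] Sb.
  have barS i : (S \in bar (J i)) = (b p \in bar (J i)).
    apply/idP/idP => [Si|bi]; last by apply: (bigcapP inS); rewrite inE.
    apply: contraR notS => nbi; apply/bigcupP; exists i => //.
    by rewrite !inE.
  pose b' q := if q == p then S else b q.
  have /(_ p) : b' =1 b; last by rewrite /b' eqxx.
  apply: minb => [q|i]; first by rewrite /b'; case: eqP => // ->.
  exists (J i) => //; apply: leq_trans (ltJ i); rewrite ltnS.
  apply: subset_leq_card; apply/subsetP => q; rewrite !inE /b'.
  by case: eqP => // ->; rewrite barS.
(* Only columns with nonempty pattern are prescribed; the others lie in C and must get 0. *)
pose l := [ffun S => if S \in \bigcup_i bar (J i)
                     then #|[set p | b p == S]| else 0].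
exists (l, Dset J set0).
  exists J; split=> // [||i].
  (* Each [bar (J i)] is closed under subsets, so nothing above an element of C can lie in it. *)
  - apply/setP => S; rewrite !inE; apply/negP => /andP[].
    rewrite ffunE; case: ifP => // /bigcupP[i _ Si] _ /exists_inP[T TD TS].
    by have /negP := Dset0P TD i; apply; apply: bar_down TS Si.
  - apply/subsetP => S; rewrite inE ffunE; case: ifP => // /bigcupP[i _ Si].
    rewrite card_fibre_neq0 => /existsP[p /eqP pS].
    apply/bigcupP; exists [set i | b p \in bar (J i)]; last by rewrite -pS; apply: bD.
    by apply/set0Pn; exists i; rewrite inE pS.
  - apply: leq_trans (ltJ i); rewrite ltnS -sum_card_fibres.
    by apply: leq_sum => S Si; rewrite ffunE; case: ifP.
move=> S /= SD; rewrite ffunE; case: ifP => // /bigcupP nS.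
apply/eqP; apply: contraR SD; rewrite card_fibre_neq0 => /existsP[p /eqP pS].
suff <- : [set i | b p \in bar (J i)] = set0 by rewrite -pS; apply: bD.
apply/setP => i; rewrite !inE; apply/negP => bi.
by apply: nS; exists i; rewrite // -pS.
Qed.

(** The right side does not mention [b]. With [f] constant it counts the prescribed columns, with
    [f] the cardinality it gives their total size. *)
Lemma sum_has_profile c (FC : FCpair c) n (b : 'I_n -> {set 'I_c})
    (f : {set 'I_c} -> nat) :
  has_profile FC b ->
  \sum_(p | b p \notin FC.2) f (b p) = \sum_(S | S \notin FC.2) FC.1 S * f S.
Proof.
move=> prof.
rewrite (partition_big b (fun S => S \notin FC.2)) //=; apply: eq_bigr => S SC.
rewrite -prof // -sum1dep_card big_distrl /=.
rewrite (eq_bigl (fun p => b p == S)) => [|p]; last first.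
  by case: eqP => [->|]; rewrite ?SC ?andbF.
by apply: eq_bigr => p /eqP ->; rewrite mul1n.
Qed.

(** A column of [b'] in C forces the column of [b] above it into C, and equal numbers of prescribed
    columns make the two index sets agree. On C equality holds because C is an antichain, elsewhere
    because the total sizes agree. *)
Lemma has_profile_antichain c s (k : 'I_s -> {set 'I_c} -> nat)
    (FC : FCpair c) n (b b' : 'I_n -> {set 'I_c}) :
  in_P k FC -> has_profile FC b -> has_profile FC b' ->
  (forall p, b' p \subset b p) -> b' =1 b.
Proof.
move=> PFC prof prof' le_b.
have inC p : b' p \in FC.2 -> b p \in FC.2.
  move=> b'C; apply/negPn/negP => bC.
  have := in_P_notin_C PFC b'C (le_b p); rewrite -prof //; apply/eqP.
  by rewrite card_fibre_neq0; apply/existsP; exists p.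
have eqC p : b' p \in FC.2 = (b p \in FC.2).
  have := sum_has_profile (fun=> 1) prof; rewrite -(sum_has_profile _ prof').
  rewrite !sum1dep_card => eq_card.
  have /setP/(_ p) : [set p | b p \notin FC.2] = [set p | b' p \notin FC.2].
    apply/eqP; rewrite eqEcard eq_card leqnn andbT; apply/subsetP => q.
    by rewrite !inE; apply: contra; apply: inC.
  by rewrite !inE => /(congr1 negb); rewrite !negbK.
move=> p; have [bC|bC] := boolP (b p \in FC.2).
  have b'C : b' p \in FC.2 by rewrite eqC.
  case: FC {prof prof' inC eqC} PFC bC b'C => l C [J [_ /= -> _ _ _]] bC b'C.
  exact: Dset_antichain b'C bC (le_b p).
apply/eqP; rewrite eqEcard le_b /=; have := sum_has_profile (fun S => #|S|) prof.
rewrite -(sum_has_profile _ prof') (eq_bigl _ _ (fun q => congr1 negb (eqC q))).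
rewrite (bigD1 p) //= [RHS](bigD1 p) //= => eq_sum.
rewrite -(leq_add2r (\sum_(q | (b q \notin FC.2) && (q != p)) #|b q|)) eq_sum.
by rewrite leq_add2l; apply: leq_sum => q _; apply: subset_leq_card.
Qed.

Lemma feasible_min c s (k : 'I_s -> {set 'I_c} -> nat) n
    (b : 'I_n -> {set 'I_c}) :
  feasible k b ->
  exists2 b' : 'I_n -> {set 'I_c}, min_feasible k b' & forall p, b' p \subset b p.
Proof.
have [N] := ubnP (\sum_p #|b p|); elim: N b => // N IH b leN feas.
have [minb|] := classic (min_feasible k b); first by exists b.
move=> nmin; have [b' [le_b' feas' neq]] : exists b' : 'I_n -> {set 'I_c},
    [/\ forall p, b' p \subset b p, feasible k b' & ~ b' =1 b].
  apply: NNPP => nex; apply: nmin; split=> // b' le_b' feas'.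
  by apply: NNPP => neq; apply: nex; exists b'.
have [|//|b'' min'' le_b''] := IH b'; last first.
  by exists b'' => // p; apply: subset_trans (le_b' p).
rewrite ltnS in leN; apply: leq_trans leN.
have [p np] : exists p, b' p != b p.
  apply/existsP; rewrite -negb_forall; apply/forallP => eqb.
  by apply: neq => p; apply/eqP.
rewrite (bigD1 p) //= [X in _ < X](bigD1 p) //= -addSn leq_add //.
  by apply: proper_card; rewrite properEneq np le_b'.
by apply: leq_sum => q _; apply: subset_leq_card.
Qed.

(** If [b] is minimal, any profiled family below it is feasible, hence equal to it. Conversely, a
    minimal family below [b] has some profile, which the exclusion clause passes on to [b]; the
    antichain property then identifies the two. *)
Lemma min_feasibleP c s (k : 'I_s -> {set 'I_c} -> nat) n
    (b : 'I_n -> {set 'I_c}) :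
  min_feasible k b <->
  exists FC : FCpair c,
    [/\ in_P k FC, has_profile FC b
      & ~ exists FC' : FCpair c,
          [/\ in_P k FC', FC' <> FC
            & (exists2 b' : 'I_n -> {set 'I_c}, has_profile FC' b' &
                 forall p, b' p \subset b p) /\ ~ has_profile FC' b]].
Proof.
split=> [minb|[FC [PFC prof nex]]].
  have [FC PFC prof] := min_feasible_has_profile minb; exists FC; split=> //.
  case=> FC' [PFC' _ [[b' prof' le_b'] nprof]]; apply: nprof.
  case: minb => _ minb; have feas' := has_profile_feasible PFC' prof'.
  exact: eq_has_profile (minb _ le_b' feas') prof'.
split=> [|b' le_b' feas']; first exact: has_profile_feasible prof.
have [b'' min'' le_b''] := feasible_min feas'.
have le2 p : b'' p \subset b p := subset_trans (le_b'' p) (le_b' p).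
have [FC' PFC' prof''] := min_feasible_has_profile min''.
(* Otherwise [FC'] would be one of the excluded pairs, with [b''] as the member below [b]. *)
have prof2 : has_profile FC' b.
  have [->//|/eqP neq] := eqVneq FC' FC; apply: NNPP => nprof; apply: nex.
  by exists FC'; split=> //; split=> //; exists b''.
move=> p; apply/eqP; rewrite eqEsubset le_b' /=.
by rewrite -(has_profile_antichain PFC' prof2 prof'' le2).
Qed.

(** * Associated primes of squarefree monomial ideals *)

Local Open Scope ring_scope.

Lemma ideal_sum (R : comNzRingType) (I : R -> Prop) (T : eqType) (r : seq T)
    (F : T -> R) :
  is_ideal I -> (forall t, t \in r -> I (F t)) -> I (\sum_(t <- r) F t).
Proof.
case=> I0 ID _ IF; rewrite big_seq.
by elim/big_ind: _ => // t /IF.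
Qed.

Lemma ideal_gen_is_ideal (R : comNzRingType) (G : R -> Prop) :
  is_ideal (ideal_gen G).
Proof.
split=> [|_ _ [r Gr ->] [r' Gr' ->]|a _ [r Gr ->]].
- by exists [::]; rewrite ?big_nil.
- exists (r ++ r'); last by rewrite big_cat.
  by move=> u; rewrite mem_cat => /orP[/Gr|/Gr'].
- exists [seq (a * u.1, u.2) | u <- r]; first by move=> _ /mapP[u /Gr Gu ->].
  by rewrite big_map mulr_sumr; apply: eq_bigr => u _; rewrite mulrA.
Qed.

Lemma ideal_gen_mem (R : comNzRingType) (G : R -> Prop) p :
  G p -> ideal_gen G p.
Proof.
move=> Gp; exists [:: (1, p)]; last by rewrite big_seq1 mul1r.
by move=> u; rewrite inE => /eqP ->.
Qed.

Lemma ideal_gen_sub (R : comNzRingType) (G I : R -> Prop) :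
  is_ideal I -> (forall p, G p -> I p) -> forall p, ideal_gen G p -> I p.
Proof.
move=> idI GI _ [r Gr ->]; apply: ideal_sum => // u /Gr/GI Iu.
by case: idI => _ _; apply.
Qed.

Lemma eq_ideal_gen (R : comNzRingType) (G G' : R -> Prop) :
  (forall p, G p <-> G' p) -> forall p, ideal_gen G p <-> ideal_gen G' p.
Proof.
move=> GG' p; split; apply: ideal_gen_sub (ideal_gen_is_ideal _) _ p => p.
  by move/GG'; apply: ideal_gen_mem.
by move/GG'; apply: ideal_gen_mem.
Qed.

Definition monomials (K : fieldType) N (E : 'X_{1..N} -> Prop)
    (p : {mpoly K[N]}) : Prop :=
  exists2 m, E m & p = 'X_[m].
Arguments monomials K {N} E p.

Lemma ideal_gen_monomialsP (K : fieldType) N (E : 'X_{1..N} -> Prop)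
    (p : {mpoly K[N]}) :
  ideal_gen (monomials K E) p <->
  forall u, u \in msupp p -> exists2 m, E m & (m <= u)%MM.
Proof.
split=> [[r Er ->] u|Ep].
  move/msupp_sum_le/flattenP=> [t /mapP[[a q]]].
  rewrite mem_filter => /= /Er[m Em /= ->] ->; rewrite (perm_mem (msuppMX _ _)).
  by case/mapP=> m' _ ->; exists m => //; apply: lem_addr.
rewrite [p]mpolyE; have idI := ideal_gen_is_ideal (monomials K E).
apply: ideal_sum => // u /Ep[m Em le_mu].
rewrite -(submK le_mu) mpolyXD -mul_mpolyC mulrA; case: idI => _ _; apply.
by apply: ideal_gen_mem; exists m.
Qed.

Lemma monomial_in_gen (K : fieldType) N (E : 'X_{1..N} -> Prop) u :
  ideal_gen (monomials K E) 'X_[u] <-> exists2 m, E m & (m <= u)%MM.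
Proof.
rewrite ideal_gen_monomialsP msuppX; split=> [|Eu v]; first by apply; rewrite inE.
by rewrite inE => /eqP ->.
Qed.

Lemma support_idealP (K : fieldType) N (m : 'X_{1..N}) (p : {mpoly K[N]}) :
  support_ideal K m p <->
  forall u, u \in msupp p -> exists2 v, (0 < m v)%N & (0 < u v)%N.
Proof.
pose E (u : 'X_{1..N}) := exists2 v, (0 < m v)%N & u = U_(v)%MM.
rewrite /support_ideal (eq_ideal_gen (G' := monomials K E)); last first.
  move=> q; split=> [[v mv ->]|[_ [v mv ->] ->]]; last by exists v.
  by exists U_(v)%MM => //; exists v.
rewrite ideal_gen_monomialsP; split=> Ep u /Ep => [[_ [v mv ->] /mnm_lepP]|].
  by move/(_ v); rewrite mnm1E eqxx; exists v.
case=> v mv uv; exists U_(v)%MM; first by exists v.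
by apply/mnm_lepP=> i; rewrite mnm1E; case: eqP => // <-.
Qed.

(* The support ideal of m is the kernel of the endomorphism killing the
   variables that divide m. *)
Lemma support_ideal_prime (K : fieldType) N (m : 'X_{1..N}) :
  is_prime_ideal (support_ideal K m).
Proof.
pose lq := [tuple (if (0 < m v)%N then 0 else 'X_v : {mpoly K[N]}) | v < N].
have kerP p : support_ideal K m p -> p \mPo lq = 0.
  case=> r mr ->; rewrite raddf_sum big_seq big1 // => u /mr[v mv ->].
  rewrite /= (rmorphM (comp_mpoly lq)) /= comp_mpolyXU -tnth_nth tnth_mktuple.
  by rewrite mv mulr0.
have idP := ideal_gen_is_ideal _ : is_ideal (support_ideal K m).
(* Termwise: a monomial containing a killed variable maps to 0 and lies in the ideal, any other is
   fixed. Hence the kernel is contained in the ideal. *)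
have imP (p : {mpoly K[N]}) : support_ideal K m (p - (p \mPo lq)).
  rewrite (comp_mpolyEX p) [X in X - _]mpolyE -sumrB; apply: ideal_sum => // u _.
  rewrite -scalerBr -mul_mpolyC; case: (idP) => P0 _; apply.
  have [/existsP[v /andP[mv uv]]|nex] :=
    boolP [exists v, (0 < m v)%N && (0 < u v)%N].
    rewrite comp_mpolyX (bigD1 v) //= tnth_mktuple mv expr0n.
    rewrite eqn0Ngt uv mul0r subr0; apply/support_idealP => w.
    by rewrite msuppX inE => /eqP ->; exists v.
  suff ->: 'X_[u] \mPo lq = 'X_[u] by rewrite subrr.
  rewrite comp_mpolyX mpolyXE_id; apply: eq_bigr => v _.
  rewrite tnth_mktuple; case: ifP => // mv; have := nex.
  by rewrite negb_exists => /forallP/(_ v); rewrite mv /= lt0n negbK => /eqP ->.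
split=> // [/support_idealP/(_ 0%MM)|a b /kerP/eqP].
  by rewrite msupp1 inE eqxx => /(_ isT)[v _]; rewrite mnm0E.
rewrite (rmorphM (comp_mpoly lq)) mulf_eq0 => /orP[] /eqP c0; [left|right].
  by have := imP a; rewrite c0 subr0.
by have := imP b; rewrite c0 subr0.
Qed.

Definition is_cover N (E : 'X_{1..N} -> Prop) (m : 'X_{1..N}) : Prop :=
  forall u, E u -> exists2 v, (0 < m v)%N & (0 < u v)%N.

(** Minimality through private monomials, the form that colon ideals produce; [is_min_coverP] links
    it to divisibility. *)
Definition is_min_cover N (E : 'X_{1..N} -> Prop) (m : 'X_{1..N}) : Prop :=
  is_cover E m /\
  forall v, (0 < m v)%N ->
    exists2 u, E u & (0 < u v)%N /\
                     forall w, (0 < m w)%N -> (0 < u w)%N -> w = v.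

(** For a minimal cover the prime is the colon by the product of the variables outside it.
    Conversely, a term [mu] of [f] outside the ideal avoids every variable of [m], so a generator
    dividing [x_v] times that term is private to [v]. *)
Lemma associated_support_ideal (K : fieldType) N (E : 'X_{1..N} -> Prop)
    (m : 'X_{1..N}) :
  (forall u, E u -> squarefree_mon u) ->
  is_associated (ideal_gen (monomials K E)) (support_ideal K m) <->
  is_min_cover E m.
Proof.
move=> sfE; split=> [[[_ P1 _] [f fP]]|[covm minm]]; last first.
  split; first exact: support_ideal_prime.
  (* The product of all variables not dividing [m]: a squarefree generator private to [v] divides it
     times [x_v]. *)
  pose f : 'X_{1..N} := [multinom (m v == 0)%N : nat | v < N].
  exists 'X_[f] => g; rewrite support_idealP ideal_gen_monomialsP.
  split=> Pg u; last first.
    move=> gu; have [|w Ew le_w] := Pg (f + u)%MM.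
      by rewrite (perm_mem (msuppMX _ _)); apply: map_f.
    have [v mv wv] := covm _ Ew; exists v => //.
    move/mnm_lepP/(_ v): le_w; rewrite mnmDE mnmE.
    by rewrite eqn0Ngt mv; apply: leq_trans.
  rewrite (perm_mem (msuppMX _ _)) => /mapP[u' /Pg[v mv u'v] ->].
  have [w Ew [wv wP]] := minm v mv; exists w => //; apply/mnm_lepP=> i.
  rewrite mnmDE mnmE; have [mi|mi] := posnP (m i).
    by apply: leq_trans (sfE _ Ew i) _.
  have [-> //|wi] := posnP (w i); rewrite (wP i mi wi).
  by apply: leq_trans (sfE _ Ew v) _; apply: leq_trans u'v _; apply: leq_addl.
have [_ _ mulI] := ideal_gen_is_ideal (monomials K E).
have covm : is_cover E m.
  move=> u Eu; have /fP/support_idealP : ideal_gen (monomials K E) ('X_[u] * f).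
    by rewrite mulrC; apply: mulI; apply: ideal_gen_mem; exists u.
  by move/(_ u); rewrite msuppX inE eqxx => /(_ isT).
split=> // v mv.
(* If every term of [f] were in the ideal, so would be [f], and the prime would contain 1. *)
have [mu muf Emu] : exists2 mu, mu \in msupp f &
    ~ exists2 u, E u & (u <= mu)%MM.
  apply: NNPP => nex; apply: P1; apply/fP; rewrite mul1r.
  apply/ideal_gen_monomialsP => mu muf; apply: NNPP => nmu.
  by apply: nex; exists mu.
have Xmu w : (0 < m w)%N -> exists2 u, E u & (u <= U_(w) + mu)%MM.
  move=> mw; have /fP : support_ideal K m 'X_w.
    apply/support_idealP => _ /[!msuppX] /[!inE] /eqP ->.
    by exists w; rewrite // mnm1E eqxx.
  rewrite mulrC ideal_gen_monomialsP; apply.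
  by rewrite (perm_mem (msuppMX _ _)); apply: map_f.
(* If [mu] already contained [w], the squarefree [u] dividing [x_w] times [mu] would divide [mu]
   itself. *)
have mu0 w : (0 < m w)%N -> mu w = 0%N.
  move=> mw; apply/eqP; rewrite eqn0Ngt; apply/negP => muw.
  have [u Eu /mnm_lepP le_u] := Xmu w mw; apply: Emu; exists u => //.
  apply/mnm_lepP => i; have := le_u i; rewrite mnmDE mnm1E.
  by case: eqP => // <- _; apply: leq_trans (sfE _ Eu w) muw.
have [u Eu /mnm_lepP le_u] := Xmu v mv; exists u => //.
have uv w : (0 < m w)%N -> (0 < u w)%N -> w = v.
  move=> mw uw; move: (leq_trans uw (le_u w)); rewrite mnmDE mnm1E mu0 // addn0.
  by case: eqP.
split=> //; have [w mw uw] := covm u Eu.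
by rewrite -(uv w mw uw).
Qed.

Lemma is_min_coverP N (E : 'X_{1..N} -> Prop) (m : 'X_{1..N}) :
  squarefree_mon m ->
  is_min_cover E m <->
  is_cover E m /\
  forall m', (m' <= m)%MM -> is_cover E m' -> m' = m.
Proof.
move=> sfm; split=> [] [covm minm]; split=> //.
  move=> m' /mnm_lepP le_m'm cov'.
  apply/mnmP=> v; apply/eqP; rewrite eqn_leq le_m'm /=.
  have [-> //|mv] := posnP (m v); have [u Eu [_ uP]] := minm v mv.
  have [w m'w uw] := cov' u Eu.
  have wv := uP w (leq_trans m'w (le_m'm w)) uw.
  by apply: leq_trans (sfm v) _; rewrite -wv.
(* Without a private monomial for [v], lowering the exponent of [v] leaves a cover, which minimality
   would equate with [m]. *)
move=> v mv; apply: NNPP => nex; have /mnmP/(_ v) : (m - U_(v))%MM = m.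
  apply: minm => [|u Eu]; first exact: lem_subr.
  apply: NNPP => nw; apply: nex; exists u => //.
  have uP w : (0 < m w)%N -> (0 < u w)%N -> w = v.
    move=> mw uw; apply: NNPP => /eqP nwv; apply: nw; exists w => //.
    by rewrite mnmBE mnm1E eq_sym (negPf nwv) subn0.
  by split=> //; have [w mw uw] := covm u Eu; rewrite -(uP w mw uw).
rewrite mnmBE mnm1E eqxx; case: (m v) mv => // x _ /eqP.
by rewrite subn1 /= eqn_leq ltnn andbF.
Qed.

(** Any monomial generating set contains [G]: each [m] in [E] is divisible by one of its monomials
    [u], and [u] by some [w] in [E]; the antichain condition gives [w = m], hence [u = m]. *)
Lemma antichain_unique_min_gens (K : fieldType) N (E : 'X_{1..N} -> Prop)
    (I G : {mpoly K[N]} -> Prop) :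
  (forall u v, E u -> E v -> (u <= v)%MM -> u = v) ->
  (forall p, G p <-> monomials K E p) ->
  (forall p, I p <-> ideal_gen G p) ->
  unique_min_monomial_gens I G.
Proof.
move=> antiE GE IG; have IE p : I p <-> ideal_gen (monomials K E) p.
  by rewrite IG; apply: eq_ideal_gen.
have subG' (G' : {mpoly K[N]} -> Prop) :
    (forall p, G' p -> exists m, p = 'X_[m]) ->
    (forall p, I p <-> ideal_gen G' p) ->
    forall p, G p -> G' p.
  move=> monG IG' _ /GE[m Em ->].
  pose E' (u : 'X_{1..N}) := G' 'X_[u].
  have G'E p : ideal_gen G' p <-> ideal_gen (monomials K E') p.
    apply: eq_ideal_gen => q; split=> [Gq|[u Gu -> //]].
    by have [u qu] := monG q Gq; exists u; rewrite // /E' -qu.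
  have /IE/IG'/G'E/monomial_in_gen[u Gu le_um] : ideal_gen (monomials K E) 'X_[m].
    by apply: ideal_gen_mem; exists m.
  have /IG'/IE/monomial_in_gen[w Ew le_wu] : ideal_gen G' 'X_[u] by apply: ideal_gen_mem.
  have wm := antiE _ _ Ew Em (lepm_trans le_wu le_um).
  suff -> : m = u by [].
  apply/mnmP => i; apply/eqP.
  by rewrite eqn_leq (mnm_lepP le_um) -{1}wm (mnm_lepP le_wu).
split=> [|G' [monG' genG' minG'] p].
  split=> // [p /GE[m _ ->]|G' subG genG']; first by exists m.
  by apply: subG' => // p /subG/GE[m _ ->]; exists m.
split; last exact: subG'.
by move=> G'p; apply: (minG' G) => //; apply: subG'.
Qed.

(** * Exponent matrices *)

Definition colset c w (B : 'M[bool]_(c, w)) (j : 'I_w) : {set 'I_c} :=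
  [set i | B i j].

Lemma card_colset_concat_blocks c (S : {set {set 'I_c}}) k T :
  #|[set j | colset (concat_blocks S k) j == T]| = (if T \in S then k T else 0)%N.
Proof.
have colE j : colset (concat_blocks S k) j = enum_val (tagnat.sig1 j).
  by apply/setP => i; rewrite inE !mxE.
under eq_finset => j do rewrite colE.
(* [tagnat] identifies a column of the concatenation with a block and a position inside it. *)
transitivity (\sum_(a < #|S| | enum_val a == T) \sum_(b < k (enum_val a)) 1)%N.
  by rewrite sig_big_dep /= (reindex _ (onW_bij _ tagnat.sig_bij)) /= sum1dep_card;
     apply: eq_card => j; rewrite !inE andbT.
under eq_bigr => a _ do rewrite sum1_card card_ord.
rewrite -(big_enum_val_cond (pred1 T) k) big_mkcondr /=.
case: ifP => TS; last first.
  by rewrite big1 // => x xS; case: eqP => // xT; rewrite xT TS in xS.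
by rewrite (bigD1 T) //= eqxx big1 ?addn0 // => x /andP[_ /negPf ->].
Qed.

Lemma card_colset_row_mx c w w' (A : 'M[bool]_(c, w)) (B : 'M[bool]_(c, w')) T :
  #|[set j | colset (row_mx A B) j == T]| =
  (#|[set j | colset A j == T]| + #|[set j | colset B j == T]|)%N.
Proof.
rewrite -!sum1dep_card big_split_ord /=; congr (_ + _)%N; apply: eq_bigl => j;
  congr (_ == _); apply/setP => i; rewrite !inE.
  by rewrite row_mxEl.
by rewrite row_mxEr.
Qed.

Lemma col_equivP c w w' (A : 'M[bool]_(c, w)) (B : 'M[bool]_(c, w')) :
  col_equiv A B <->
  forall T, #|[set j | colset A j == T]| = #|[set j | colset B j == T]|.
Proof.
pose g (v : 'cV[bool]_c) := [set i | v i 0].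
have g_inj : injective g.
  by move=> u v /setP eq_uv; apply/colP => i; have := eq_uv i; rewrite !inE.
have gE x (D : 'M[bool]_(c, x)) T :
    count_mem T (map g [seq col j D | j <- enum 'I_x]) =
    #|[set j | colset D j == T]|.
  rewrite -map_comp count_map -sum1_count big_enum_cond /= sum1dep_card.
  apply: eq_card => j; rewrite !inE; congr (_ == _).
  by apply/setP => i; rewrite !inE mxE.
split=> [eqAB T|eqAB].
  by rewrite -!gE; have /seq.permP := perm_map g eqAB; apply.
by apply: (perm_map_inj g_inj); apply/allP => T _ /=; rewrite !gE eqAB.
Qed.

(** The free multiplicities are read off from [B]. For pairs in P the sets F and C are disjoint, so
    no column is counted in both groups of blocks. *)
Lemma G_FC_has_profile c s (k : 'I_s -> {set 'I_c} -> nat) (FC : FCpair c) n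
    (B : 'M[bool]_(c, n)) :
  in_P k FC -> G_FC FC B <-> has_profile FC (colset B).
Proof.
move=> PFC; have C0 S : S \in FC.2 -> FC.1 S = 0%N.
  by move=> SC; apply: in_P_notin_C PFC SC _.
case: FC C0 {PFC} => l C /= C0; split=> [[l' _ /col_equivP cntB] S /= SC|prof].
  rewrite cntB card_colset_row_mx !card_colset_concat_blocks (negPf SC) addn0.
  by rewrite inE; case: eqP.
pose l' S := #|[set j | colset B j == S]|.
exists l'; last first.
  apply/col_equivP => S.
  rewrite card_colset_row_mx !card_colset_concat_blocks inE.
  case: ifP => [lS|/negPn/eqP lS]; case: ifP => SC //=.
  - by rewrite C0 ?eqxx // in lS.
  - by rewrite addn0 prof //= SC.
  - by rewrite prof //= SC.
have <- : (\sum_(S in setT) l' S)%N = n.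
  by rewrite sum_card_fibres -[RHS]card_ord; apply: eq_card => j; rewrite !inE.
rewrite [RHS](bigID (mem C)) /= addnC; congr (_ + _)%N.
  by apply: eq_bigl => S; rewrite inE.
rewrite [RHS](eq_bigr l) => [|S /andP[_ SC]]; last exact: prof.
rewrite big_mkcond [RHS]big_mkcond; apply: eq_bigr => S _; rewrite !inE /=.
have [->|lS] := eqVneq (l S) 0%N; first by rewrite if_same.
by case: (boolP (S \in C)) => // /C0 /eqP; rewrite (negPf lS).
Qed.

Definition mexp c n (B : 'M[bool]_(c, n)) : 'X_{1..c * n} :=
  [multinom (mxvec B 0%R v : nat) | v < c * n].

Lemma mexpE c n (B : 'M[bool]_(c, n)) i j : mexp B (mxvec_index i j) = B i j.
Proof. by rewrite mnmE mxvecE. Qed.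

Lemma mexp_gt0 c n (B : 'M[bool]_(c, n)) i j :
  (0 < mexp B (mxvec_index i j))%N = B i j.
Proof. by rewrite mexpE; case: (B i j). Qed.

Lemma squarefree_mexp c n (B : 'M[bool]_(c, n)) : squarefree_mon (mexp B).
Proof. by case/mxvec_indexP => i j; rewrite mexpE; case: (B i j). Qed.

Lemma squarefree_monP c n (m : 'X_{1..c * n}) :
  squarefree_mon m -> exists B : 'M[bool]_(c, n), m = mexp B.
Proof.
move=> sfm; exists (\matrix_(i, j) (0 < m (mxvec_index i j))%N).
apply/mnmP; case/mxvec_indexP => i j; rewrite mexpE mxE.
by have := sfm (mxvec_index i j); case: (m _) => [|[]].
Qed.

Lemma mexp_leP c n (B B' : 'M[bool]_(c, n)) :
  (mexp B' <= mexp B)%MM <-> forall j, colset B' j \subset colset B j.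
Proof.
split=> [/mnm_lepP le_B j|sub_B].
  apply/subsetP => i; rewrite !inE -!mexp_gt0 => B'i.
  exact: leq_trans B'i (le_B _).
apply/mnm_lepP; case/mxvec_indexP => i j; rewrite !mexpE.
by have /subsetP/(_ i) := sub_B j; rewrite !inE; case: (B' i j) => // ->.
Qed.

Lemma colset_inj c n (B B' : 'M[bool]_(c, n)) : colset B =1 colset B' -> B = B'.
Proof.
by move=> eqB; apply/matrixP => i j; have /setP/(_ i) := eqB j; rewrite !inE.
Qed.

Lemma colsetK c n (b : 'I_n -> {set 'I_c}) : exists B, colset B =1 b.
Proof.
by exists (\matrix_(i, j) (i \in b j)) => j; apply/setP => i; rewrite inE mxE.
Qed.

Lemma xmonE (K : fieldType) c n (B : 'M[bool]_(c, n)) :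
  xmon K B = 'X_[mexp B].
Proof.
rewrite mpolyXE_id (reindex _ (curry_mxvec_bij c n)) /= /xmon pair_big /=.
by apply: eq_bigr => -[i j] _ /=; rewrite mexpE.
Qed.

(** The substitution moves column [j] to position [sigma j], whereas [col_perm] looks columns up,
    hence the inverse. *)
Lemma sym_act_xmon (K : fieldType) c n (sigma : 'S_n) (B : 'M[bool]_(c, n)) :
  sym_act sigma (xmon K B) = xmon K (col_perm sigma^-1 B).
Proof.
rewrite xmonE /sym_act comp_mpolyX (reindex _ (curry_mxvec_bij c n)) /=.
rewrite /xmon pair_big /=.
rewrite [RHS](reindex (fun p : 'I_c * 'I_n => (p.1, sigma p.2))) /=; last first.
  exists (fun p : 'I_c * 'I_n => (p.1, sigma^-1%g p.2)) => -[i j] _ /=.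
    by rewrite permK.
  by rewrite permKV.
apply: eq_bigr => -[i j] _ /=.
by rewrite tnth_mktuple mxvecE !mxE permK mexpE.
Qed.

Definition orbit_exponents c n (M : 'M[bool]_(c, n) -> Prop)
    (u : 'X_{1..c * n}) : Prop :=
  exists2 B, M B & exists sigma : 'S_n, u = mexp (col_perm sigma B).

Lemma orbitsE (K : fieldType) c n (M : 'M[bool]_(c, n) -> Prop) p :
  orbits K M p <-> monomials K (orbit_exponents M) p.
Proof.
split=> [[B [MB [sigma ->]]]|[_ [B MB [sigma ->]] ->]].
  exists (mexp (col_perm sigma^-1 B)); last by rewrite sym_act_xmon xmonE.
  by exists B => //; exists sigma^-1%g.
by exists B; split=> //; exists sigma^-1%g; rewrite sym_act_xmon xmonE invgK.
Qed.

Lemma colset_col_perm c n sigma (B : 'M[bool]_(c, n)) j :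
  colset (col_perm sigma B) j = colset B (sigma j).
Proof. by apply/setP => i; rewrite !inE mxE. Qed.

Lemma card_perm_fibre (T : eqType) n (sigma : 'S_n) (P : pred T)
    (b : 'I_n -> T) :
  #|[set p | P (b (sigma p))]| = #|[set p | P (b p)]|.
Proof.
rewrite -(card_imset _ (@perm_inj _ sigma)); apply: eq_card => p; rewrite !inE.
apply/imsetP/idP => [[q]|Pp]; first by rewrite inE => Pq ->.
by exists (sigma^-1%g p); rewrite ?inE permKV.
Qed.

(** Multiplicities ignore column order, so divisibility by an orbit monomial becomes plain
    columnwise inclusion. *)
Lemma I_FC_has_profile (K : fieldType) c s (k : 'I_s -> {set 'I_c} -> nat)
    (FC : FCpair c) n (B : 'M[bool]_(c, n)) :
  in_P k FC ->
  I_FC K FC B <->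
  exists2 b : 'I_n -> {set 'I_c}, has_profile FC b &
    forall j, b j \subset colset B j.
Proof.
move=> PFC; rewrite /I_FC (eq_ideal_gen (@orbitsE K _ _ _)) xmonE monomial_in_gen.
split=> [[_ [B' /(G_FC_has_profile _ PFC) prof [sigma ->]]]|[b prof le_b]].
  move/mexp_leP => le_B; exists (colset (col_perm sigma B')) => // S SC.
  under eq_finset => j do rewrite colset_col_perm.
  by rewrite (card_perm_fibre _ (pred1 S)) /=; apply: prof.
have [B' B'b] := colsetK b; exists (mexp B').
  exists B'; last by exists 1%g; rewrite col_perm1.
  by apply/(G_FC_has_profile _ PFC); apply: eq_has_profile prof.
by apply/mexp_leP => j; rewrite B'b.
Qed.

Lemma G_dual_min_feasible (K : fieldType) c s (k : 'I_s -> {set 'I_c} -> nat) n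
    (B : 'M[bool]_(c, n)) :
  G_dual K k B <-> min_feasible k (colset B).
Proof.
rewrite min_feasibleP; split=> -[FC [PFC GB nex]]; exists FC; split=> //.
- exact/(G_FC_has_profile _ PFC).
- case=> FC' [PFC' neq [ex' nprof]]; apply: nex; exists FC'; split=> //.
  by split; [apply/(I_FC_has_profile K _ PFC')|move/(G_FC_has_profile _ PFC')].
- exact/(G_FC_has_profile _ PFC).
- case=> FC' [PFC' neq [I' nG]]; apply: nex; exists FC'; split=> //.
  by split; [apply/(I_FC_has_profile K _ PFC')|move/(G_FC_has_profile _ PFC')].
Qed.

(** * Column permutations and covers of the given orbits *)

Lemma eq_min_feasible c s (k : 'I_s -> {set 'I_c} -> nat) n
    (b b' : 'I_n -> {set 'I_c}) :
  b =1 b' -> min_feasible k b -> min_feasible k b'.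
Proof.
move=> eqb [feas minb]; split=> [|d le_d feas_d p]; first exact: eq_feasible feas.
by rewrite -eqb; apply: minb => // q; rewrite eqb.
Qed.

(** Ensures that passing to orbits adds no monomials beyond those of the minimal covers. *)
Lemma min_feasible_perm c s (k : 'I_s -> {set 'I_c} -> nat) n (sigma : 'S_n)
    (b : 'I_n -> {set 'I_c}) :
  min_feasible k b -> min_feasible k (b \o sigma).
Proof.
have feas_perm (tau : 'S_n) (d : 'I_n -> {set 'I_c}) :
    feasible k d -> feasible k (d \o tau).
  move=> fd i; have [J pJ ltJ] := fd i; exists J => //.
  by rewrite (card_perm_fibre tau (mem (bar J)) d).
case=> feas minb; split=> [|b' le_b' feas' p]; first exact: feas_perm.
rewrite -[p in LHS](permK sigma) /=.
apply: (minb (b' \o sigma^-1)%g) => [q /=|]; last exact: feas_perm.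
by have := le_b' (sigma^-1%g q); rewrite /= permKV.
Qed.

Lemma card_colset_pad c w n (A : 'M[bool]_(c, w)) (T : {set 'I_c}) :
  (w <= n)%N -> T != set0 ->
  #|[set j | colset (pad n A) j == T]| = #|[set j | colset A j == T]|.
Proof.
move=> le_wn T0; have inj : injective (widen_ord le_wn).
  by move=> x y /(congr1 val) /= xy; apply: val_inj.
have padE j : colset (pad n A) (widen_ord le_wn j) = colset A j.
  by apply/setP => i; rewrite !inE mxE /= valK.
rewrite -[RHS](card_imset _ inj); apply: eq_card => j; rewrite !inE.
apply/eqP/imsetP => [jT|[j' j'T ->]]; last first.
  by rewrite padE; move: j'T; rewrite inE => /eqP.
have [lt_jw|le_wj] := ltnP j w.
  have jE : j = widen_ord le_wn (Ordinal lt_jw) by apply: val_inj.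
  by exists (Ordinal lt_jw); rewrite // inE -padE -jE jT.
case/eqP: T0; rewrite -jT; apply/setP => i.
by rewrite !inE mxE insubF //= ltnNge le_wj.
Qed.

(** Covering one orbit means that under every permutation some column of the padded [A i] meets the
    matched column of [B]; this is the transversal condition settled by Hall's theorem. *)
Lemma is_cover_feasible c s n (w : 'I_s -> nat) (A : forall i, 'M[bool]_(c, w i))
    (k : 'I_s -> {set 'I_c} -> nat) (B : 'M[bool]_(c, n)) :
  (forall i, w i <= n)%N ->
  (forall i, col_equiv (A i) (concat_blocks [set~ set0] (k i))) ->
  is_cover (orbit_exponents (fun P => exists i, P = pad n (A i))) (mexp B) <->
  feasible k (colset B).
Proof.
move=> le_wn hA.
have coverE :
    is_cover (orbit_exponents (fun P => exists i, P = pad n (A i))) (mexp B)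
    <-> forall i, forall sigma : 'S_n,
        exists j, ~~ [disjoint colset (pad n (A i)) j & colset B (sigma j)].
  split=> [cov i sigma|cov _ [_ [i ->] [sigma ->]]].
    have [|v] := cov (mexp (col_perm sigma^-1 (pad n (A i)))).
      by exists (pad n (A i)); [exists i|exists sigma^-1%g].
    case/mxvec_indexP: v => a j; rewrite !mexp_gt0 mxE => Baj Aaj.
    exists (sigma^-1%g j); apply/pred0Pn; exists a.
    by rewrite /= !inE permKV Baj andbT.
  have [j /pred0Pn[a /=]] := cov i sigma^-1%g.
  rewrite !inE => /andP[Aaj Baj]; exists (mxvec_index a (sigma^-1%g j)).
    by rewrite mexp_gt0.
  by rewrite mexp_gt0 mxE permKV.
(* The empty set is not in [J], as upward closure would make [J] everything; so the count sees only
   nonempty columns, whose multiplicities [hA] supplies. *)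
rewrite coverE; have cntE i J : proper_order_ideal J ->
    #|[set j | colset (pad n (A i)) j \in J]| = (\sum_(T in J) k i T)%N.
  case/and3P=> _ JT /forall_inP upJ; rewrite -sum_card_fibres.
  apply: eq_bigr => T TJ; have T0 : T != set0.
    apply: contra JT => /eqP T0; apply/eqP/setP => S; rewrite inE.
    by have /forallP/(_ S)/implyP := upJ _ TJ; apply; rewrite T0 sub0set.
  rewrite card_colset_pad //; have /col_equivP -> := hA i.
  by rewrite card_colset_concat_blocks !inE T0.
split=> cov i; last first.
  apply/transversal_order_idealP; have [J pJ ltJ] := cov i.
  by exists J; rewrite ?cntE.
by have /transversal_order_idealP[J pJ] := cov i; rewrite cntE //; exists J.
Qed.

Theorem theorem6p12 (K : fieldType) (c m s : nat)
    (c_gt0 : (0 < c)%N) (m_gt0 : (0 < m)%N) (s_gt0 : (0 < s)%N)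
    (w : 'I_s -> nat) (A : forall i : 'I_s, 'M[bool]_(c, w i))
    (k : 'I_s -> {set 'I_c} -> nat)
    (hw : forall i, (w i <= m)%N)
    (hA : forall i, col_equiv (A i) (concat_blocks [set~ set0] (k i)))
    (n : nat) (hn : (m <= n)%N) :
  unique_min_monomial_gens (alexander_dual (orbit_ideal K n A))
    (orbits K (G_dual K k (n := n))).
Proof.
pose E := orbit_exponents (fun P : 'M[bool]_(c, n) => exists i, P = pad n (A i)).
have sfE u : E u -> squarefree_mon u.
  by case=> B _ [sigma ->]; apply: squarefree_mexp.
have covE B : is_cover E (mexp B) <-> feasible k (colset B).
  by apply: is_cover_feasible => // i; apply: leq_trans (hw i) hn.
have minE B : is_min_cover E (mexp B) <-> min_feasible k (colset B).
  rewrite is_min_coverP ?covE; last exact: squarefree_mexp.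
  split=> -[feas minB]; split=> //.
    move=> b le_b feas_b; have [B' B'b] := colsetK b.
    suff BB' : mexp B' = mexp B.
      move=> j; rewrite -B'b; congr (colset _ j); apply/matrixP => x y.
      by rewrite -!mexp_gt0 BB'.
    apply: minB; first by apply/mexp_leP => j; rewrite B'b.
    by apply/covE; apply: eq_feasible feas_b => j; rewrite B'b.
  (* A divisor of a squarefree monomial is squarefree, so it again comes from a matrix. *)
  move=> m' le_m' covm'; have [|B' m'E] := @squarefree_monP c n m'.
    move=> v; apply: leq_trans (squarefree_mexp B v).
    by move/mnm_lepP: le_m'.
  rewrite m'E in le_m' covm' *; congr mexp; apply: colset_inj.
  by apply: minB; [apply/mexp_leP|apply/covE].
pose D u := exists2 B : 'M[bool]_(c, n), min_feasible k (colset B) & u = mexp B.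
have orbD p : orbits K (G_dual K k (n := n)) p <-> monomials K D p.
  rewrite orbitsE; split=> -[u Du ->]; exists u => //.
    case: Du => B /G_dual_min_feasible minB [sigma ->].
    exists (col_perm sigma B) => //.
    apply: eq_min_feasible (min_feasible_perm sigma minB) => j.
    by rewrite colset_col_perm.
  case: Du => B minB ->; exists B; first exact/G_dual_min_feasible.
  by exists 1%g; rewrite col_perm1.
apply: (antichain_unique_min_gens (E := D)) => [|//|p].
  move=> _ _ [B [fB _] ->] [B' [_ minB'] ->] /mexp_leP le_B.
  by rewrite (colset_inj (minB' _ le_B fB)).
rewrite (eq_ideal_gen orbD); apply: eq_ideal_gen => q.
have assE (u : 'X_{1..c * n}) :
    is_associated (orbit_ideal K n A) (support_ideal K u) <-> is_min_cover E u.
  rewrite -(associated_support_ideal K _ sfE).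
  have IE g : orbit_ideal K n A g <-> ideal_gen (monomials K E) g.
    by apply: eq_ideal_gen; apply: orbitsE.
  split=> -[prP [f fP]]; split=> //; exists f => g; rewrite fP.
    by rewrite IE.
  by rewrite -IE.
split=> [[u [sfu /assE minu ->]]|[_ [B minB ->] ->]].
  have [B uE] := squarefree_monP sfu; exists u => //; exists B => //.
  by apply/minE; rewrite -uE.
by exists (mexp B); split=> //; [apply: squarefree_mexp|apply/assE/minE].
Qed.
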